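(* Let $K(\theta,s)=\sum_{j=0}^{m-1}K^j(\theta)(b_0s)^j$, $W(\theta,s)=\sum_{j=0}^{k-1}W^j(\theta)(bs)^j$ and $\widetilde W(\theta,s)=\sum_{j=0}^{k-1}\widetilde W^j(\theta)(bs)^j$ be as in the context, with $k\le m\le n_\theta$, and assume that $K^j$, $W^j$ and $\widetilde W^j$ are expressed with $n_\theta$ Fourier coefficients. Then the computational complexity of computing the compositions of $K$ with $W$ and with $\widetilde W$ (as polynomials in $s$, on the mesh of $n_\theta$ values of $\theta$), using automatic differentiation as described in the context, is $\Theta(mk\,n_\theta^2)$.
   Context: Here $K^j:\mathbb R\to\mathbb R^2$ are $1$-periodic, $W=(W_1,W_2)$ and $\widetilde W=(\widetilde W_1,\widetilde W_2)$ take values in $\mathbb R^2$, with $W^j,\widetilde W^j$ $1$-periodic for $j\ge1$ and $W^0(\theta)-(\theta,0)$, $\widetilde W^0(\theta)-(\theta,0)$ $1$-periodic (for $j=0$ these periodic parts are what is expressed in Fourier coefficients); $b_0,b>0$ are scaling factors. The function $\widetilde W$ is (the truncation in powers of $s$ of) $W\bigl(\theta-\omega r(K(W(\theta,s))),\,s\,e^{-\lambda r(K(W(\theta,s)))}\bigr)$ for given $\omega>0$, $\lambda<0$ and a positive delay function $r$ on $\mathbb R^2$; its coefficients $\widetilde W^j$ are taken as given. Each real periodic function is represented by a truncated real Fourier series $$S(\theta)=\frac{a_0}2+\frac{a_{n_\theta/2}}2\cos(\pi n_\theta\theta)+\sum_{l=1}^{\lceil n_\theta/2\rceil-1}a_l\cos(2\pi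 l\theta)+b_l\sin(2\pi l\theta)$$ with $n_\theta$ real coefficients (the $a_{n_\theta/2}$ term is present only for even $n_\theta$), the mesh being $\theta_i=i/n_\theta$, $0\le i<n_\theta$. For each mesh value of $\theta$, the composition is computed, truncated at degree $k-1$ in $s$, via $$K\circ W(\theta,s)=\sum_{j=0}^{m-1}K^j(W_1(\theta,s))\,\bigl(b_0W_2(\theta,s)\bigr)^j$$ by Horner's scheme; likewise with $\widetilde W$ in place of $W$. The polynomials $K^j\circ W_1$ are obtained by direct summation of the Fourier series of $K^j$ (componentwise) at the polynomial $W_1(\theta,\cdot)$, the sines and cosines of polynomials being computed by automatic differentiation: for $q(s)=\sum_j q_js^j$, the coefficients $s_j$ of $\sin q(s)$ and $c_j$ of $\cos q(s)$ are given by $s_0=\sin q_0$, $c_0=\cos q_0$ and, for $j\ge1$, $$s_j=\frac1j\sum_{i=0}^{j-1}(j-i)q_{j-i}c_i,\qquad c_j=-\frac1j\sum_{i=0}^{j-1}(j-i)q_{j-i}s_i .$$ For a given $\theta$, the sines and cosines $\sin(2\pi lW_1)$, $\cos(2\pi lW_1)$ are the same for all $K^j$. Complexity counts arithmetic operations (real sine and cosine evaluations having unit cost); polynomial products are done by the classical (schoolbook) method. *)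

(* Defs.v *)
From mathcomp Require Import all_boot all_order all_algebra.
From mathcomp Require Import all_classical all_reals all_analysis.
Set Implicit Arguments.
Unset Strict Implicit.
Unset Printing Implicit Defensive.
Import Order.TTheory GRing.Theory Num.Theory.
Import numFieldNormedType.Exports.
Local Open Scope ring_scope.

(* Coefficients a_l, b_l of a real trigonometric series.  The truncation with n
   real coefficients uses a_0, ..., a_(n/2) and b_1, ..., b_(ceil(n/2) - 1)
   only; the other entries are never read. *)
Record fourier (R : Type) := Fourier { fa : nat -> R; fb : nat -> R }.

Definition fourier_eval (R : realType) (n : nat) (f : fourier R) (x : R) : R :=
  fa f 0 / 2
  + (if odd n then 0 else fa f n./2 / 2 * cos (pi * n%:R * x))
  + \sum_(1 <= l < uphalf n)
      (fa f l * cos (2 * pi * l%:R * x) + fb f l * sin (2 * pi * l%:R * x)).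

(* A sequence of periodic functions R -> R^2, given by the Fourier coefficients
   of the two components. *)
Definition fourier2s (R : Type) := nat -> fourier R * fourier R.

Definition K_eval (R : realType) (n m : nat) (b0 : R) (K : fourier2s R)
    (x : R * R) : R * R :=
  (\sum_(j < m) fourier_eval n (K j).1 x.1 * (b0 * x.2) ^+ j,
   \sum_(j < m) fourier_eval n (K j).2 x.1 * (b0 * x.2) ^+ j).

(* The Fourier coefficients of index 0 are those of W^0(theta) - (theta, 0). *)
Definition W_eval (R : realType) (n k : nat) (b : R) (W : fourier2s R)
    (theta s : R) : R * R :=
  (theta + \sum_(j < k) fourier_eval n (W j).1 theta * (b * s) ^+ j,
   \sum_(j < k) fourier_eval n (W j).2 theta * (b * s) ^+ j).

(* [p] is the truncation of [f] at degree k - 1, p`_j being the coefficient of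
   s ^+ j. *)
Definition truncation (R : realType) (k : nat) (f : R -> R) (p : seq R) : Prop :=
  size p = k /\ (fun s => f s - (Poly p).[s]) =O_ (nbhs (0 : R)) (fun s => s ^+ k).

(* Computations that return a value together with the number of arithmetic
   operations performed.  Reading data and using the constants n%:R and 2 * pi
   is free. *)
Definition comp (A : Type) : Type := (A * nat)%type.
Definition result (A : Type) (c : comp A) : A := c.1.
Definition opcount (A : Type) (c : comp A) : nat := c.2.
Definition ret (A : Type) (a : A) : comp A := (a, 0%N).
Definition bind (A B : Type) (c : comp A) (f : A -> comp B) : comp B :=
  ((f c.1).1, (c.2 + (f c.1).2)%N).

Notation "'let!' x := c 'in' e" := (bind c (fun x => e))
  (at level 200, x pattern, c at level 100, e at level 200).

Fixpoint mkseqM (A : Type) (N : nat) (f : nat -> comp A) : comp (seq A) :=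
  if N is N'.+1 then
    let! s := mkseqM N' f in
    let! x := f N' in
    ret (rcons s x)
  else ret [::].

Section Algorithm.
Variable R : realType.
Implicit Types (p q : seq R) (k n m : nat).

Definition addM (x y : R) : comp R := (x + y, 1%N).
Definition oppM (x : R) : comp R := (- x, 1%N).
Definition mulM (x y : R) : comp R := (x * y, 1%N).
Definition divM (x y : R) : comp R := (x / y, 1%N).
Definition sinM (x : R) : comp R := (sin x, 1%N).
Definition cosM (x : R) : comp R := (cos x, 1%N).

Fixpoint sumM (N : nat) (f : nat -> comp R) : comp R :=
  if N is N'.+1 then
    let! a := sumM N' f in
    let! x := f N' in
    addM a x
  else ret 0.

(* Polynomials in s modulo s ^+ k are sequences of k coefficients. *)

Definition constP k (c : R) : seq R := c :: nseq k.-1 0.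

Definition addP k p q : comp (seq R) := mkseqM k (fun i => addM p`_i q`_i).

Definition scaleP k (a : R) p : comp (seq R) := mkseqM k (fun i => mulM a p`_i).

Definition mulP k p q : comp (seq R) :=
  mkseqM k (fun i => sumM i.+1 (fun j => mulM p`_j q`_(i - j))).

(* The first k coefficients of sin q(s) and of cos q(s). *)
Fixpoint sincosP k q : comp (seq R * seq R) :=
  match k with
  | 0 => ret ([::], [::])
  | j.+1 =>
    let! (sn, cs) := sincosP j q in
    if j == 0%N then
      let! s0 := sinM q`_0 in
      let! c0 := cosM q`_0 in
      ret ([:: s0], [:: c0])
    else
      let! u := sumM j (fun i =>
        let! t := mulM (j - i)%:R q`_(j - i) in mulM t cs`_i) in
      let! v := sumM j (fun i =>
        let! t := mulM (j - i)%:R q`_(j - i) in mulM t sn`_i) in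
      let! h := divM 1 j%:R in
      let! sj := mulM h u in
      let! w := mulM h v in
      let! cj := oppM w in
      ret (rcons sn sj, rcons cs cj)
  end.

(* Entry l - 1 of the table holds (sin (2 pi l q(s)), cos (2 pi l q(s))), for
   1 <= l <= n/2. *)
Definition trig_table n k q : comp (seq (seq R * seq R)) :=
  mkseqM n./2 (fun l' =>
    let! a := mulM (2 * pi) l'.+1%:R in
    let! aq := scaleP k a q in
    sincosP k aq).

Definition tsin (T : seq (seq R * seq R)) (l : nat) : seq R :=
  (nth ([::], [::]) T l.-1).1.
Definition tcos (T : seq (seq R * seq R)) (l : nat) : seq R :=
  (nth ([::], [::]) T l.-1).2.

(* acc + \sum_(1 <= l < N.+1) (a_l cos (2 pi l q(s)) + b_l sin (2 pi l q(s))) *)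
Fixpoint harmonicsP k (f : fourier R) (T : seq (seq R * seq R)) (acc : seq R)
    (N : nat) : comp (seq R) :=
  if N is l'.+1 then
    let! p := harmonicsP k f T acc l' in
    let! c := scaleP k (fa f l'.+1) (tcos T l'.+1) in
    let! s := scaleP k (fb f l'.+1) (tsin T l'.+1) in
    let! cs := addP k c s in
    addP k p cs
  else ret acc.

(* Direct summation of the series [f] at the polynomial q(s) whose trigonometric
   table is [T]. *)
Definition fourierP n k (f : fourier R) (T : seq (seq R * seq R)) :
    comp (seq R) :=
  let! a0 := divM (fa f 0) 2 in
  let! p :=
    if odd n then ret (constP k a0) else
      let! h := divM (fa f n./2) 2 in
      let! c := scaleP k h (tcos T n./2) in
      addP k (constP k a0) c in
  harmonicsP k f T p (uphalf n).-1.

(* Horner's scheme modulo s ^+ k for \sum_j Q_j(s) * X(s) ^+ j. *)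
Fixpoint hornerP k (Q : seq (seq R)) (X : seq R) : comp (seq R) :=
  match Q with
  | [::] => ret (nseq k 0)
  | [:: q] => ret q
  | q :: Q' =>
    let! h := hornerP k Q' X in
    let! t := mulP k h X in
    addP k t q
  end.

(* [:: 1; b; ...; b ^+ k.-1] *)
Fixpoint powersM k (b : R) : comp (seq R) :=
  match k with
  | 0 => ret [::]
  | 1 => ret [:: 1]
  | k'.+1 =>
    let! s := powersM k' b in
    let! x := mulM (last 1 s) b in
    ret (rcons s x)
  end.

(* Coefficients in s of the two components of W(theta, s); a scalar is a
   polynomial modulo s, so its series are summed by [fourierP] with k = 1. *)
Definition W_poly n k (b : R) (W : fourier2s R) (theta : R) :
    comp (seq R * seq R) :=
  let! pw := powersM k b in
  let! T := trig_table n 1 [:: theta] in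
  let! W1 := mkseqM k (fun j =>
    let! v := fourierP n 1 (W j).1 T in
    if j == 0%N then addM theta v`_0 else mulM v`_0 pw`_j) in
  let! W2 := mkseqM k (fun j =>
    let! v := fourierP n 1 (W j).2 T in
    mulM v`_0 pw`_j) in
  ret (W1, W2).

(* The two components of K(W(theta, s)) modulo s ^+ k.  The table [T] is shared
   by all the K^j. *)
Definition compose_at n m k (b0 b : R) (K W : fourier2s R) (theta : R) :
    comp (seq R * seq R) :=
  let! (W1, W2) := W_poly n k b W theta in
  let! X := scaleP k b0 W2 in
  let! T := trig_table n k W1 in
  let! Q1 := mkseqM m (fun j => fourierP n k (K j).1 T) in
  let! Q2 := mkseqM m (fun j => fourierP n k (K j).2 T) in
  let! P1 := hornerP k Q1 X in
  let! P2 := hornerP k Q2 X in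
  ret (P1, P2).

Definition compose_mesh n m k (b0 b : R) (K W : fourier2s R) :
    comp (seq (seq R * seq R)) :=
  mkseqM n (fun i =>
    let! theta := divM i%:R n%:R in
    compose_at n m k b0 b K W theta).

Definition compositions n m k (b0 b : R) (K W Wt : fourier2s R) :
    comp (seq (seq R * seq R) * seq (seq R * seq R)) :=
  let! C := compose_mesh n m k b0 b K W in
  let! Ct := compose_mesh n m k b0 b K Wt in
  ret (C, Ct).

End Algorithm.

(* [P] lists, for each mesh point i / n, the two components of
   s |-> K(W(i / n, s)) truncated at degree k - 1. *)
Definition is_composition (R : realType) (n m k : nat) (b0 b : R)
    (K W : fourier2s R) (P : seq (seq R * seq R)) : Prop :=
  size P = n /\
  forall i : nat, (i < n)%N ->
    let KW s := K_eval n m b0 K (W_eval n k b W (i%:R / n%:R) s) in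
    let Pi := nth ([::], [::]) P i in
    truncation k (fun s => (KW s).1) Pi.1 /\
    truncation k (fun s => (KW s).2) Pi.2.

(* Main.v *)
Require Import Defs.
From mathcomp Require Import all_boot all_order all_algebra.
From mathcomp Require Import all_classical all_reals all_analysis.
From mathcomp Require Import ring zify.
(** Correctness rests on one calculus of truncations: [truncation k] says that a
    function and its k computed coefficients differ by O(s ^ k) at 0.  Each
    routine on polynomials transports this relation: sums, scalings and products
    do because remainders that are O(s ^ k) form an ideal among the functions
    bounded near 0 ([truncation_add], [truncation_scale], [truncation_mul]), and
    hence so do Fourier sums and Horner's scheme ([truncation_fourier],
    [truncation_horner]).

    The only analytic point is that the automatic differentiation recurrences
    produce the Taylor coefficients of sin q(s) and cos q(s)
    ([truncation_sincos]).  The recurrences say that the polynomials S and C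
    satisfy S' = q' C and C' = - q' S up to O(s ^ (k - 1)).  Rotating (S, C) back
    by the angle q, the functions S cos q - C sin q and S sin q + C cos q - 1
    vanish at 0 and have derivatives O(s ^ (k - 1)), so by the mean value theorem
    they are O(s ^ k) ([derive_order_ge]); rotating forward again gives
    sin q - S and cos q - C.  No estimate on the Taylor series of sin and cos is
    involved.

    The operation count is a sum over the n mesh points.  At one mesh point,
    summing one Fourier series at a polynomial takes Theta(k n) operations
    ([opcount_fourierP_le], [opcount_fourierP_ge]), and there are 2 m series:
    this already gives the order m k n, from below as well.  All else is
    dominated by it because k <= m and k <= n: the coefficients of W cost O(k n),
    the shared table of sines and cosines O(n k ^ 2), and Horner's scheme
    O(m k ^ 2) ([opcount_compose_at]). *)
Set Implicit Arguments.
Unset Strict Implicit.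
Unset Printing Implicit Defensive.
Import Order.TTheory GRing.Theory Num.Theory.
Import numFieldNormedType.Exports.
Local Open Scope ring_scope.

(** * Orders of vanishing at 0 *)

Section VanishingOrder.
Variable R : realType.
Local Open Scope classical_set_scope.
Implicit Types (f g df : R -> R) (p q : {poly R}) (i j k : nat).

Definition order_ge k f : Prop := f =O_ (nbhs (0 : R)) (fun s => s ^+ k).

Lemma order_geP k f : order_ge k f <->
  exists2 M, 0 < M & \forall s \near (0 : R), `|f s| <= M * `|s| ^+ k.
Proof.
rewrite /order_ge; split.
  move=> /eqO_exP[M M0 H]; exists M => //.
  by apply: filterS H => s; rewrite normrX.
move=> [M M0 H]; apply/eqO_exP; exists M => //.
by apply: filterS H => s; rewrite normrX.
Qed.

Lemma order_ge_ext k f g : f =1 g -> order_ge k f -> order_ge k g.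
Proof. by move=> /funext ->. Qed.

Lemma order_ge_at0 k f : (0 < k)%N -> order_ge k f -> f 0 = 0.
Proof.
move=> k0 /order_geP[M M0 /nbhs_singleton].
by rewrite normr0 expr0n gtn_eqF// mulr0 normr_le0 => /eqP.
Qed.

Lemma order_ge_cst0 k : order_ge k (fun=> 0).
Proof.
apply/order_geP; exists 1 => //; apply: filterE => s.
by rewrite normr0 mul1r exprn_ge0.
Qed.

Lemma order_geD k f g :
  order_ge k f -> order_ge k g -> order_ge k (fun s => f s + g s).
Proof.
move=> /order_geP[M M0 Hf] /order_geP[N N0 Hg]; apply/order_geP.
exists (M + N); first exact: addr_gt0.
apply: filterS2 Hf Hg => s Hf Hg.
by rewrite (le_trans (ler_normD _ _))// mulrDl lerD.
Qed.

Lemma order_geM j k f g :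
  order_ge j f -> order_ge k g -> order_ge (j + k) (fun s => f s * g s).
Proof.
move=> /order_geP[M M0 Hf] /order_geP[N N0 Hg]; apply/order_geP.
exists (M * N); first exact: mulr_gt0.
apply: filterS2 Hf Hg => s Hf Hg.
by rewrite normrM exprD mulrACA ler_pM.
Qed.

Lemma order_geMl k f g : order_ge 0 f -> order_ge k g ->
  order_ge k (fun s => f s * g s).
Proof. exact: order_geM. Qed.

Lemma order_geMr k f g : order_ge k f -> order_ge 0 g ->
  order_ge k (fun s => f s * g s).
Proof. by move=> Hf Hg; rewrite -[k]addn0; exact: order_geM. Qed.

Lemma order_geW k f : order_ge k f -> order_ge 0 f.
Proof.
move=> /order_geP[M M0 Hf]; apply/order_geP; exists M => //.
have s1 : \forall s \near (0 : R), `|s| < 1.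
  apply/nbhs0P; apply/nbhs_ballP; exists 1 => //= s.
  by rewrite /ball /= sub0r normrN add0r.
apply: filterS2 Hf s1 => s Hf s1; apply: (le_trans Hf).
by rewrite ler_pM2l// expr0 exprn_ile1// ltW.
Qed.

(** With [order_geMl] and [order_geMr], this lets a continuous factor be ignored
    in a remainder. *)
Lemma continuous_order_ge0 f : {for 0, continuous f} -> order_ge 0 f.
Proof.
move=> /cvgrPdist_lt /(_ 1 ltr01) H; apply/order_geP.
exists (`|f 0| + 1); first by rewrite ltr_wpDl.
apply: filterS H => s H; rewrite expr0 mulr1.
rewrite -[f s](subrK (f 0)) addrC (le_trans (ler_normD _ _))// lerD2l.
by rewrite distrC ltW.
Qed.

Lemma poly_order_ge k p : (forall i, (i < k)%N -> p`_i = 0) ->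
  order_ge k (horner p).
Proof.
move=> p0; apply: (@order_ge_ext _ (fun s => (drop_poly k p).[s] * s ^+ k)).
  move=> s; rewrite -[in RHS](poly_take_drop k p) hornerD hornerM hornerXn.
  suff -> : take_poly k p = 0 by rewrite horner0 add0r.
  by apply/polyP => i; rewrite coef_take_poly coef0; case: ifP => // /p0.
apply: order_geMl; last by apply/order_geP; exists 1 => //; apply: filterE => s;
  rewrite mul1r normrX.
by apply: continuous_order_ge0; exact: continuous_horner.
Qed.

(** By the mean value theorem, f(s) = f'(c) s with |c| <= |s|. *)
Lemma derive_order_ge k f df :
  (forall x : R, is_derive x (1 : R) f (df x)) -> f 0 = 0 ->
  order_ge k df -> order_ge k.+1 f.
Proof.
move=> fdf f0 /order_geP[M M0 Hd]; apply/order_geP; exists M => //.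
have [e /= e0 He] := (nbhs_ballP (0 : R) _).1 Hd.
apply/nbhs_ballP; exists e => //= s; rewrite /ball /= sub0r normrN => se.
have cf (a b : R) : {within `[a, b], continuous f}.
  apply: derivable_within_continuous => x _; exact: ex_derive.
have bd (c : R) : `|c| <= `|s| -> `|df c| <= M * `|s| ^+ k.
  move=> cs; apply: le_trans (He c _) _.
    by rewrite /ball /= sub0r normrN (le_lt_trans cs).
  by rewrite ler_pM2l// lerXn2r ?nnegrE.
suff [c cs ->] : exists2 c, `|c| <= `|s| & f s = df c * s.
  by rewrite normrM exprSr mulrA ler_wpM2r// bd.
have [s0|/ltW s0] := leP 0 s.
  have [c] := MVT_segment s0 (fun x _ => fdf x) (cf _ _).
  rewrite in_itv /= f0 !subr0 => /andP[c0 cs] ->; exists c => //.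
  by rewrite !ger0_norm.
have [c] := MVT_segment s0 (fun x _ => fdf x) (cf _ _).
rewrite in_itv /= f0 !sub0r => /andP[cs c0] /eqP.
rewrite mulrN eqr_opp => /eqP ->; exists c => //.
by rewrite !ler0_norm// lerN2.
Qed.

End VanishingOrder.

(** * Truncations computed by the routines on polynomials *)

Section Correctness.
Variable R : realType.
Implicit Types (f g x : R -> R) (p q : seq R) (i j k l m n N : nat).

Lemma result_mkseqM (A : Type) N (f : nat -> Defs.comp A) :
  result (mkseqM N f) = mkseq (fun i => result (f i)) N.
Proof. by elim: N => //= N IH; rewrite mkseqS -IH. Qed.

Lemma result_sumM N (f : nat -> Defs.comp R) :
  result (sumM N f) = \sum_(i < N) result (f i).
Proof.
by elim: N => [|N IH] /=; rewrite ?big_ord0// big_ord_recr -IH.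
Qed.

(** It suffices to compare with a polynomial P of any degree: for a product P is
    the full product, of which only the first k coefficients are computed. *)
Lemma truncation_coef k f p (P : {poly R}) : size p = k ->
  order_ge k (fun s => f s - P.[s]) -> (forall i, (i < k)%N -> p`_i = P`_i) ->
  truncation k f p.
Proof.
move=> szp HP eqpP; split=> //.
have /(order_geD HP) : order_ge k (horner (P - Poly p)).
  by apply: poly_order_ge => i ik; rewrite coefB coef_Poly eqpP// subrr.
by apply: order_ge_ext => s; rewrite hornerD hornerN; ring.
Qed.

Lemma truncation_ext k f g p : f =1 g -> truncation k f p -> truncation k g p.
Proof. by move=> /funext ->. Qed.

Lemma truncation_order0 k f p : truncation k f p -> order_ge 0 f.
Proof.
move=> [_ /order_geW H]; apply: (@order_ge_ext _ _
  (fun s => f s - (Poly p).[s] + (Poly p).[s])); first by move=> s; ring.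
by apply: order_geD => //; apply: continuous_order_ge0; exact: continuous_horner.
Qed.

Lemma truncation_nseq0 k : truncation k (fun=> 0 : R) (nseq k 0).
Proof.
apply: (@truncation_coef _ _ _ 0); first exact: size_nseq.
  by apply: (order_ge_ext _ (order_ge_cst0 R k)) => s; rewrite horner0 subrr.
by move=> i _; rewrite nth_nseq if_same coef0.
Qed.

Lemma truncation_const k (c : R) : (0 < k)%N ->
  truncation k (fun=> c) (constP k c).
Proof.
case: k => // k _; apply: (@truncation_coef _ _ _ c%:P).
- by rewrite /= size_nseq.
- by apply: (order_ge_ext _ (order_ge_cst0 R k.+1)) => s; rewrite hornerC subrr.
- by move=> [|i] _; rewrite coefC //= nth_nseq if_same.
Qed.

Lemma truncation_add k f g p q : truncation k f p -> truncation k g q ->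
  truncation k (fun s => f s + g s) (result (addP k p q)).
Proof.
move=> [_ fp] [_ gq]; rewrite /addP result_mkseqM.
apply: (@truncation_coef _ _ _ (Poly p + Poly q)); first exact: size_mkseq.
  by apply: (order_ge_ext _ (order_geD fp gq)) => s; rewrite hornerD; ring.
by move=> i ik; rewrite nth_mkseq// coefD !coef_Poly.
Qed.

Lemma truncation_scale k (a : R) f p : truncation k f p ->
  truncation k (fun s => a * f s) (result (scaleP k a p)).
Proof.
move=> [_ fp]; rewrite /scaleP result_mkseqM.
apply: (@truncation_coef _ _ _ (a *: Poly p)); first exact: size_mkseq.
  apply: (@order_ge_ext _ _ (fun s => (a%:P).[s] * (f s - (Poly p).[s]))).
    by move=> s; rewrite hornerC hornerZ; ring.
  apply: order_geMl fp; apply: continuous_order_ge0; exact: continuous_horner.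
by move=> i ik; rewrite nth_mkseq// coefZ !coef_Poly.
Qed.

(** f g - P Q = (f - P) g + P (g - Q), where g and P are bounded near 0. *)
Lemma truncation_mul k f g p q : truncation k f p -> truncation k g q ->
  truncation k (fun s => f s * g s) (result (mulP k p q)).
Proof.
move=> fp gq; have g0 := truncation_order0 gq.
case: fp gq => [_ fp] [_ gq]; rewrite /mulP result_mkseqM.
have p0 : order_ge 0 (horner (Poly p)).
  by apply: continuous_order_ge0; exact: continuous_horner.
apply: (@truncation_coef _ _ _ (Poly p * Poly q)); first exact: size_mkseq.
  apply: (order_ge_ext _ (order_geD (order_geMr fp g0) (order_geMl p0 gq))) => s.
  by rewrite hornerM; ring.
move=> i ik; rewrite nth_mkseq// result_sumM coefM.
by apply: eq_bigr => j _; rewrite !coef_Poly.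
Qed.

Lemma is_derive_horner_mul_comp (T q : {poly R}) (h dh : R -> R) (s : R) :
  (forall y : R, is_derive y (1 : R) h (dh y)) ->
  is_derive s (1 : R) (fun s => T.[s] * h q.[s])
    (T^`().[s] * h q.[s] + T.[s] * (dh q.[s] * q^`().[s])).
Proof.
move=> Hh; have Hq := is_derive_poly q s.
have Hc : is_derive s (1 : R) (h \o horner q) (dh q.[s] * q^`().[s]).
  exact: (is_derive1_comp (Hh _) Hq).
apply: (is_derive_eq (is_deriveM (is_derive_poly T s) Hc)).
by rewrite /GRing.scale /=; ring.
Qed.

(** The pair (S, C) satisfies the differential equation of (sin q, cos q) up to
    s ^ k.  Multiplying it by the rotation of angle - q kills the linear part of
    the equation, which leaves only the remainders to integrate. *)
Lemma sin_cos_order_ge k (S C q : {poly R}) :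
  S`_0 = sin q`_0 -> C`_0 = cos q`_0 ->
  (forall i, (i < k)%N -> S^`()`_i = (q^`() * C)`_i) ->
  (forall i, (i < k)%N -> C^`()`_i = - (q^`() * S)`_i) ->
  order_ge k.+1 (fun s => sin q.[s] - S.[s]) /\
  order_ge k.+1 (fun s => cos q.[s] - C.[s]).
Proof.
move=> S0 C0 dS dC.
have ES : order_ge k (horner (S^`() - q^`() * C)).
  by apply: poly_order_ge => i ik; rewrite coefB dS// subrr.
have EC : order_ge k (horner (C^`() + q^`() * S)).
  by apply: poly_order_ge => i ik; rewrite coefD dC// addNr.
have bnd (h : R -> R) : continuous h -> order_ge 0 (fun s => h q.[s]).
  move=> ch; apply: continuous_order_ge0.
  by apply: continuous_comp; [exact: continuous_horner|exact: ch].
have bs := bnd _ (@continuous_sin R); have bc := bnd _ (@continuous_cos R).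
have bNs : order_ge 0 (fun s => - sin q.[s]).
  by apply: (bnd (fun y => - sin y)) => y; apply: continuousN; exact: continuous_sin.
(* A and B are the coordinates of (S, C) rotated by - q, minus (0, 1). *)
have A : order_ge k.+1 (fun s => S.[s] * cos q.[s] - C.[s] * sin q.[s]).
  apply: (derive_order_ge (df := fun s =>
      (S^`() - q^`() * C).[s] * cos q.[s]
      + (C^`() + q^`() * S).[s] * - sin q.[s])).
  - move=> s; apply: (is_derive_eq (is_deriveB
      (is_derive_horner_mul_comp S q s (@is_derive_cos R))
      (is_derive_horner_mul_comp C q s (@is_derive_sin R)))).
    by rewrite !hornerE /=; ring.
  - by rewrite !horner_coef0 S0 C0; ring.
  - exact: order_geD (order_geMr ES bc) (order_geMr EC bNs).
have B : order_ge k.+1 (fun s => S.[s] * sin q.[s] + C.[s] * cos q.[s] - 1).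
  apply: (derive_order_ge (df := fun s =>
      (S^`() - q^`() * C).[s] * sin q.[s]
      + (C^`() + q^`() * S).[s] * cos q.[s])).
  - move=> s; apply: (is_derive_eq (is_deriveB (is_deriveD
      (is_derive_horner_mul_comp S q s (@is_derive_sin R))
      (is_derive_horner_mul_comp C q s (@is_derive_cos R)))
      (@is_derive_cst R R R (1 : R) s (1 : R)))).
    by rewrite !hornerE /=; ring.
  - by rewrite !horner_coef0 S0 C0 -!expr2 [X in X - 1]addrC cos2Dsin2 subrr.
  - exact: order_geD (order_geMr ES bs) (order_geMr EC bc).
have bNc : order_ge 0 (fun s => - cos q.[s]).
  by apply: (bnd (fun y => - cos y)) => y; apply: continuousN; exact: continuous_cos.
(* sin q - S = - A cos q - B sin q and cos q - C = A sin q - B cos q *)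
split.
- apply: (order_ge_ext _ (order_geD (order_geMr A bNc) (order_geMr B bNs))) => s.
  have := cos2Dsin2 q.[s]; set c := cos _; set d := sin _ => cd.
  by transitivity (d - S.[s] * (c ^+ 2 + d ^+ 2)); [ring | rewrite cd mulr1].
- apply: (order_ge_ext _ (order_geD (order_geMr A bs) (order_geMr B bNc))) => s.
  have := cos2Dsin2 q.[s]; set c := cos _; set d := sin _ => cd.
  by transitivity (c - C.[s] * (c ^+ 2 + d ^+ 2)); [ring | rewrite cd mulr1].
Qed.

(** The recurrence for the final sequences: appending entries to S and C does not
    change the prefixes that earlier entries were computed from. *)
Lemma sincosP_spec k q (S := (result (sincosP k q)).1)
    (C := (result (sincosP k q)).2) :
  [/\ size S = k, size C = k
    & forall j, (j < k)%N ->
      S`_j = (if j == 0%N then sin q`_0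
              else j%:R^-1 * \sum_(i < j) (j - i)%:R * q`_(j - i) * C`_i) /\
      C`_j = (if j == 0%N then cos q`_0
              else - (j%:R^-1 * \sum_(i < j) (j - i)%:R * q`_(j - i) * S`_i))].
Proof.
rewrite {}/S {}/C; elim: k => [|k]; first by split.
rewrite /= ; case: (sincosP k q) => -[S C] c /= [szS szC IH].
case: (eqVneq k 0%N) => [->|k0] /=; first by split=> // -[|j].
rewrite ![(sumM _ _).1]result_sumM /= !size_rcons szS szC; split=> // j.
rewrite ltnS => jk; rewrite !nth_rcons szS szC.
have U_rcons (U : seq R) u : size U = k ->
    \sum_(i < j) (j - i)%:R * q`_(j - i) * (rcons U u)`_i =
    \sum_(i < j) (j - i)%:R * q`_(j - i) * U`_i.
  move=> szU; apply: eq_bigr => i _.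
  by rewrite nth_rcons szU (leq_trans (ltn_ord i)).
rewrite !U_rcons//; case: ltngtP jk => // [/IH//|->] _.
by rewrite (negPf k0) !mul1r.
Qed.

(** For k > 0 the recurrence of index j = i + 1 is the equality of the
    coefficients of s ^ i in S' and q' C (and in C' and - q' S). *)
Lemma truncation_sincos k q : let SC := result (sincosP k q) in
  truncation k (fun s => sin (Poly q).[s]) SC.1 /\
  truncation k (fun s => cos (Poly q).[s]) SC.2.
Proof.
move=> SC; have [szS szC SCE] := sincosP_spec k q; rewrite -/SC in szS szC SCE.
suff [sS cC] : order_ge k (fun s => sin (Poly q).[s] - (Poly SC.1).[s]) /\
               order_ge k (fun s => cos (Poly q).[s] - (Poly SC.2).[s]).
  by split; split.
have bnd (h : R -> R) : continuous h ->
    order_ge 0 (fun s => h (Poly q).[s]).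
  move=> ch; apply: continuous_order_ge0.
  by apply: continuous_comp; [exact: continuous_horner|exact: ch].
case: k => [|k] in SC szS szC SCE *.
  rewrite (size0nil szS) (size0nil szC); split.
    by apply: (order_ge_ext _ (bnd _ (@continuous_sin R))) => s;
      rewrite horner0 subr0.
  by apply: (order_ge_ext _ (bnd _ (@continuous_cos R))) => s;
    rewrite horner0 subr0.
have coef_deriv_mul i (U : seq R) :
    i.+1%:R * (i.+1%:R^-1 * \sum_(j < i.+1) (i.+1 - j)%:R * q`_(i.+1 - j) * U`_j)
    = ((Poly q)^`() * Poly U)`_i.
  rewrite mulrA mulfV ?pnatr_eq0// mul1r coefMr.
  apply: eq_bigr => j _; rewrite coef_deriv !coef_Poly.
  by rewrite (subSn (ltn_ord j : (j <= i)%N)) mulr_natl.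
have [//|/= S0 C0] := SCE 0%N.
apply: sin_cos_order_ge; rewrite ?coef_Poly//.
  move=> i ik; have [//|/= SE _] := SCE i.+1.
  by rewrite coef_deriv coef_Poly SE -[LHS]mulr_natl coef_deriv_mul.
move=> i ik; have [//|/= _ CE] := SCE i.+1.
by rewrite coef_deriv coef_Poly CE -[LHS]mulr_natl mulrN coef_deriv_mul.
Qed.


(** The function x is arbitrary rather than a polynomial, so that the same lemmas
    serve for x = W_1(theta, .) and, with k = 1, for the scalar theta. *)
Definition trig_table_of n k x (T : seq (seq R * seq R)) : Prop :=
  forall l, (0 < l <= n./2)%N ->
    truncation k (fun s => sin (2 * pi * l%:R * x s)) (tsin T l) /\
    truncation k (fun s => cos (2 * pi * l%:R * x s)) (tcos T l).

Lemma trig_table_correct n k q : (size q <= k)%N ->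
  trig_table_of n k (horner (Poly q)) (result (trig_table n k q)).
Proof.
move=> szq l /andP[l0 ln].
rewrite /tsin /tcos /trig_table result_mkseqM nth_mkseq; last by case: l l0 ln.
rewrite prednK//=.
set aq := (scaleP _ _ _).1; have [sn cs] := truncation_sincos k aq.
suff E s : (Poly aq).[s] = 2 * pi * l%:R * (Poly q).[s].
  by split; [apply: truncation_ext sn|apply: truncation_ext cs] => s; rewrite E.
rewrite -hornerZ; congr _.[_]; apply/polyP => i.
rewrite coefZ !coef_Poly [aq]result_mkseqM.
have [ik|ki] := ltnP i k; first by rewrite nth_mkseq.
by rewrite !nth_default ?mulr0 ?size_mkseq// (leq_trans szq).
Qed.

Lemma truncation_harmonics n k F T x acc f N : (N <= n./2)%N ->
  trig_table_of n k x T -> truncation k f acc ->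
  truncation k
    (fun s => f s + \sum_(1 <= l < N.+1) (fa F l * cos (2 * pi * l%:R * x s)
                                        + fb F l * sin (2 * pi * l%:R * x s)))
    (result (harmonicsP k F T acc N)).
Proof.
move=> + HT facc; elim: N => [_|N IH Nn].
  by apply: truncation_ext facc => s; rewrite big_geq// addr0.
have [sn cs] := HT N.+1 Nn.
apply: truncation_ext (truncation_add (IH (ltnW Nn)) (truncation_add
  (truncation_scale (fa F N.+1) cs) (truncation_scale (fb F N.+1) sn))) => s.
by rewrite [in RHS]big_nat_recr//= [RHS]addrA.
Qed.

Lemma truncation_fourier n k F T x : (0 < n)%N -> (0 < k)%N ->
  trig_table_of n k x T ->
  truncation k (fun s => fourier_eval n F (x s)) (result (fourierP n k F T)).
Proof.
move=> n0 k0 HT.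
have uphalf_gt0 : (0 < uphalf n)%N by case: n n0 {HT}.
rewrite /fourier_eval -(prednK uphalf_gt0).
rewrite /fourierP /=; apply: (@truncation_harmonics n) => //.
  by rewrite -ltnS prednK// uphalf_half; case: odd.
have [_|evn] := boolP (odd n).
  by apply: truncation_ext (truncation_const (fa F 0 / 2) k0) => s; rewrite addr0.
(* As n is even and positive, its last cosine has index n / 2 in the table. *)
have n2 : (0 < n./2 <= n./2)%N.
  by rewrite leqnn andbT; case: n n0 evn {HT uphalf_gt0} => [|[|n]].
have [_ cs] := HT _ n2.
apply: truncation_ext (truncation_add (truncation_const _ k0)
  (truncation_scale _ cs)) => s /=.
have -> // : pi * n%:R = 2 * pi * n./2%:R :> R.
by rewrite -[in LHS](even_halfK evn) -mul2n natrM; ring.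
Qed.

Lemma truncation_horner k (Q : seq (seq R)) X (g : nat -> R -> R) x :
  truncation k x X ->
  (forall j, (j < size Q)%N -> truncation k (g j) (nth [::] Q j)) ->
  truncation k (fun s => \sum_(j < size Q) g j s * x s ^+ j)
    (result (hornerP k Q X)).
Proof.
move=> HX; elim: Q g => [|q Q IH] g HQ.
  by apply: truncation_ext (truncation_nseq0 k) => s; rewrite big_ord0.
have H0 : truncation k (g 0%N) q := HQ 0%N isT; have {}IH := IH _ (fun j => HQ j.+1).
case: Q {HQ} IH => [_|q' Q IH].
  by apply: truncation_ext H0 => s; rewrite big_ord1 mulr1.
apply: truncation_ext (truncation_add (truncation_mul IH HX) H0) => s.
rewrite [in RHS]big_ord_recl expr0 mulr1 addrC; congr (_ + _).
by rewrite big_distrl; apply: eq_bigr => i _; rewrite exprSr mulrA.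
Qed.

Lemma result_powersM k (b : R) :
  result (powersM k b) = mkseq (fun i => b ^+ i) k.
Proof.
elim: k => [//|[//|k] IH].
have -> : result (powersM k.+2 b) =
  rcons (result (powersM k.+1 b)) (last 1 (result (powersM k.+1 b)) * b) by [].
by rewrite IH !mkseqS last_rcons exprSr.
Qed.

(** Modulo s the remainder is a constant that is O(s), hence 0: the value is
    exact. *)
Lemma fourierP_scalar n F T (theta : R) : (0 < n)%N ->
  trig_table_of n 1 (fun=> theta) T ->
  (result (fourierP n 1 F T))`_0 = fourier_eval n F theta.
Proof.
move=> n0 HT.
have [_ H] := truncation_fourier F n0 (ltnSn 0) HT.
have := order_ge_at0 (ltnSn 0) H.
by rewrite horner_coef0 coef_Poly => /eqP; rewrite subr_eq0 => /eqP ->.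
Qed.

(** W is itself a polynomial of degree less than k in s, so there is no remainder
    here. *)
Lemma W_poly_correct n k (b : R) (W : fourier2s R) (theta s : R) (n0 : (0 < n)%N)
    (k0 : (0 < k)%N) (P := result (W_poly n k b W theta)) :
  [/\ size P.1 = k, size P.2 = k
    & W_eval n k b W theta s = ((Poly P.1).[s], (Poly P.2).[s])].
Proof.
have HT : trig_table_of n 1 (fun=> theta) (result (trig_table n 1 [:: theta])).
  move=> l ln; have [//|sn cs] := @trig_table_correct n 1 [:: theta] _ l ln.
  by split; [apply: truncation_ext sn|apply: truncation_ext cs] => y;
    rewrite /= cons_poly_def mul0r add0r hornerC.
have HV F : (fourierP n 1 F (trig_table n 1 [:: theta]).1).1`_0 =
  fourier_eval n F theta by exact: fourierP_scalar.
have pwE i : (i < k)%N -> (powersM k b).1`_i = b ^+ i.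
  by move=> ik; rewrite [(powersM k b).1]result_powersM nth_mkseq.
rewrite {}/P /W_poly /=; move: (powersM k b) pwE => pw pwE.
rewrite ![(mkseqM k _).1]result_mkseqM !size_mkseq; split=> //.
rewrite /W_eval.
have horner_mkseq (F : nat -> R) : (Poly (mkseq F k)).[s] = \sum_(j < k) F j * s ^+ j.
  have szF := size_Poly (mkseq F k); rewrite size_mkseq in szF.
  rewrite (horner_coef_wide _ szF).
  by apply: eq_bigr => j _; rewrite coef_Poly nth_mkseq.
rewrite !horner_mkseq; congr (_, _).
  case: k k0 pwE horner_mkseq => // k _ pwE _; rewrite !big_ord_recl addrA /=; congr (_ + _).
    by rewrite !mulr1 HV.
  apply: eq_bigr => i _; rewrite HV.
  by rewrite pwE ?exprMn ?mulrA// ltnS.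
apply: eq_bigr => i _; rewrite /= HV.
by rewrite pwE ?ltn_ord// exprMn mulrA.
Qed.

Lemma compose_at_correct n m k (b0 b : R) (K W : fourier2s R) (theta : R)
    (P := result (compose_at n m k b0 b K W theta))
    (KW := fun s => K_eval n m b0 K (W_eval n k b W theta s)) :
  (0 < n)%N -> (0 < k)%N ->
  truncation k (fun s => (KW s).1) P.1 /\ truncation k (fun s => (KW s).2) P.2.
Proof.
move=> n0 k0; rewrite {}/KW {}/P /compose_at.
have HW s := W_poly_correct b W theta s n0 k0.
case: (W_poly n k b W theta) HW => -[W1 W2] c HW.
have szW1 : size W1 = k by have [] := HW 0.
have szW2 : size W2 = k by have [] := HW 0.
have {}HW s : W_eval n k b W theta s =
  ((Poly W1).[s], (Poly W2).[s]) by have [] := HW s.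
have HX : truncation k (fun s => b0 * (Poly W2).[s]) (result (scaleP k b0 W2)).
  apply: truncation_scale; split=> //.
  by apply: (order_ge_ext _ (order_ge_cst0 R k)) => s; rewrite subrr.
have HT : trig_table_of n k (horner (Poly W1)) (result (trig_table n k W1)).
  by apply: trig_table_correct; rewrite szW1.
have HQ (F : nat -> fourier R) : truncation k
    (fun s => \sum_(j < m) fourier_eval n (F j) (Poly W1).[s]
                           * (b0 * (Poly W2).[s]) ^+ j)
    (result (hornerP k
      (result (mkseqM m (fun j =>
        fourierP n k (F j) (result (trig_table n k W1)))))
      (result (scaleP k b0 W2)))).
  rewrite result_mkseqM.
  have := @truncation_horner k (mkseq (fun i =>
    result (fourierP n k (F i) (result (trig_table n k W1)))) m) _
    (fun j s => fourier_eval n (F j) (Poly W1).[s]) _ HX.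
  rewrite size_mkseq; apply=> j jm; rewrite nth_mkseq//.
  exact: truncation_fourier.
split; [apply: truncation_ext (HQ (fun j => (K j).1))
       |apply: truncation_ext (HQ (fun j => (K j).2))] => s; by rewrite HW.
Qed.

Lemma compose_mesh_correct n m k (b0 b : R) (K W : fourier2s R) :
  (0 < n)%N -> (0 < k)%N ->
  is_composition n m k b0 b K W (result (compose_mesh n m k b0 b K W)).
Proof.
move=> n0 k0; rewrite /compose_mesh result_mkseqM; split.
  exact: size_mkseq.
by move=> i ni; rewrite nth_mkseq//; exact: compose_at_correct.
Qed.

End Correctness.

(** * Operation counts *)

Section Complexity.
Variable R : realType.
Local Open Scope nat_scope.
Implicit Types (p q : seq R) (i j k l m n N : nat).

Lemma opcount_bind (A B : Type) (c : Defs.comp A) (f : A -> Defs.comp B) :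
  opcount (bind c f) = opcount c + opcount (f (result c)).
Proof. by []. Qed.

Lemma opcount_mkseqM (A : Type) N (f : nat -> Defs.comp A) c :
  (forall i, i < N -> opcount (f i) = c) -> opcount (mkseqM N f) = N * c.
Proof.
elim: N => [//|N IH] Hf; rewrite [mkseqM _ _]/= !opcount_bind addn0 Hf// mulSn addnC.
by rewrite IH// => i iN; apply: Hf; exact: ltnW.
Qed.

Lemma opcount_mkseqM_le (A : Type) N (f : nat -> Defs.comp A) c :
  (forall i, i < N -> opcount (f i) <= c) -> opcount (mkseqM N f) <= N * c.
Proof.
elim: N => [//|N IH] Hf; rewrite [mkseqM _ _]/= !opcount_bind addn0 mulSn addnC.
by rewrite leq_add ?Hf// IH// => i iN; apply: Hf; exact: ltnW.
Qed.

Lemma opcount_mkseqM_ge (A : Type) N (f : nat -> Defs.comp A) c :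
  (forall i, i < N -> c <= opcount (f i)) -> N * c <= opcount (mkseqM N f).
Proof.
elim: N => [//|N IH] Hf; rewrite [mkseqM _ _]/= !opcount_bind addn0 mulSn addnC.
by rewrite leq_add ?Hf// IH// => i iN; apply: Hf; exact: ltnW.
Qed.

Lemma opcount_sumM N (f : nat -> Defs.comp R) c :
  (forall i, i < N -> opcount (f i) = c) -> opcount (sumM N f) = N * c.+1.
Proof.
elim: N => [//|N IH] Hf; rewrite [sumM _ _]/= !opcount_bind Hf// IH.
  by rewrite /addM /opcount /=; lia.
by move=> i iN; apply: Hf; exact: ltnW.
Qed.

Lemma opcount_addP k p q : opcount (addP k p q) = k.
Proof. by rewrite /addP (@opcount_mkseqM _ _ _ 1)// muln1. Qed.

Lemma opcount_scaleP k (a : R) p : opcount (scaleP k a p) = k.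
Proof. by rewrite /scaleP (@opcount_mkseqM _ _ _ 1)// muln1. Qed.

Lemma opcount_mulP k p q : opcount (mulP k p q) <= k * (2 * k).
Proof.
apply: opcount_mkseqM_le => i ik.
by rewrite (@opcount_sumM _ _ 1)// mulnC leq_mul2l.
Qed.

(** Step j > 0 takes 6 j + 4 operations, at most the increment of 4 j ^ 2. *)
Lemma opcount_sincosP k q : opcount (sincosP k q) <= 4 * (k * k).
Proof.
elim: k => [//|k IH]; rewrite [sincosP _ _]/= opcount_bind.
case: (result (sincosP k q)) => sn cs.
case: (eqVneq k 0) IH => [->|k0] IH; first by rewrite /opcount /=; lia.
rewrite !opcount_bind !(@opcount_sumM _ _ 2)// /opcount /=.
by move: IH; rewrite /opcount; nia.
Qed.

Lemma opcount_trig_table n k q : 0 < k ->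
  opcount (trig_table n k q) <= 3 * (n * (k * k)).
Proof.
move=> k0; have H : opcount (trig_table n k q) <= n./2 * (6 * (k * k)).
  apply: opcount_mkseqM_le => l _; rewrite !opcount_bind opcount_scaleP.
  have := opcount_sincosP k (result (scaleP k
    (result (mulM (2 * pi : R)%R l.+1%:R)) q)).
  rewrite [opcount (mulM _ _)]/=; nia.
apply: leq_trans H _; have : n./2 * 2 <= n by lia.
by nia.
Qed.

Lemma opcount_harmonicsP k (f : fourier R) T acc N :
  opcount (harmonicsP k f T acc N) = N * (4 * k).
Proof.
elim: N => [//|N IH].
rewrite [harmonicsP _ _ _ _ _]/= !opcount_bind IH !opcount_scaleP !opcount_addP.
by lia.
Qed.

Lemma opcount_fourierP n k (f : fourier R) T :
  opcount (fourierP n k f T) =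
  (if odd n then 1 else 2 + 2 * k) + (uphalf n).-1 * (4 * k).
Proof.
rewrite /fourierP !opcount_bind opcount_harmonicsP; case: odd => //.
rewrite !opcount_bind opcount_scaleP opcount_addP /opcount /=; lia.
Qed.

Lemma opcount_fourierP_le n k (f : fourier R) T : 0 < n -> 0 < k ->
  opcount (fourierP n k f T) <= 6 * (k * n).
Proof.
move=> n0 k0; rewrite opcount_fourierP uphalf_half.
have := odd_double_half n; case: odd => /= En; nia.
Qed.

(** For n = 1 the series is a constant that costs a single operation; this is
    k n because then k = 1. *)
Lemma opcount_fourierP_ge n k (f : fourier R) T : 0 < k <= n ->
  k * n <= opcount (fourierP n k f T).
Proof.
move=> /andP[k0 kn]; rewrite opcount_fourierP uphalf_half.
have := odd_double_half n; case: odd => /= En; last by nia.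
by case: (n./2) En => [|h] En; nia.
Qed.

Lemma opcount_hornerP k (Q : seq (seq R)) X : 0 < k ->
  opcount (hornerP k Q X) <= size Q * (3 * (k * k)).
Proof.
move=> k0; elim: Q => [//|q [//|q' Q] IH].
rewrite [hornerP _ _ _]/= -/(hornerP k (q' :: Q) X).
rewrite !opcount_bind opcount_addP; move: IH.
set h := hornerP k (q' :: Q) X.
rewrite -[size [:: q, q' & Q]]/(size (q' :: Q)).+1.
by have := opcount_mulP k (result h) X; move: (size _); nia.
Qed.

Lemma opcount_powersM k (b : R) : opcount (powersM k b) <= k.
Proof.
elim: k => [//|[//|k] IH].
rewrite [powersM _ _]/= -/(powersM k.+1 b) !opcount_bind.
by rewrite /= addn0 addn1.
Qed.

Lemma opcount_W_poly n k (b : R) (W : fourier2s R) (theta : R) :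
  0 < n -> 0 < k -> opcount (W_poly n k b W theta) <= 18 * (k * n).
Proof.
move=> n0 k0; rewrite /W_poly !opcount_bind addn0.
set pw := result (powersM k b); set T := result (trig_table _ _ _).
have HP := opcount_powersM k b.
have HT := opcount_trig_table n [:: theta] (ltnSn 0).
have H1 : opcount (mkseqM k (fun j => let! v := fourierP n 1 (W j).1 T in
    if j == 0%N then addM theta v`_0 else mulM v`_0 pw`_j)%R) <= k * (7 * n).
  apply: opcount_mkseqM_le => j _; rewrite opcount_bind.
  have := opcount_fourierP_le (W j).1 T n0 (ltnSn 0).
  by case: ifP => _; [rewrite [opcount (addM _ _)]/=|rewrite [opcount (mulM _ _)]/=]; lia.
have H2 : opcount (mkseqM k (fun j => let! v := fourierP n 1 (W j).2 T in
    mulM v`_0 pw`_j)%R) <= k * (7 * n).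
  apply: opcount_mkseqM_le => j _; rewrite opcount_bind.
  have := opcount_fourierP_le (W j).2 T n0 (ltnSn 0).
  by rewrite [opcount (mulM _ _)]/=; lia.
by move: H1 H2 HP HT; nia.
Qed.

(** The lower bound is the cost of the Fourier sums of the first components
    alone.  In units of m k n, the constant 40 collects 18 for W, 1 for b_0 W_2,
    3 for the table, and, for each of the two components, 6 for the Fourier sums
    and 3 for Horner's scheme. *)
Lemma opcount_compose_at n m k (b0 b : R) (K W : fourier2s R) (theta : R) :
  0 < k -> k <= m -> m <= n ->
  m * (k * n) <= opcount (compose_at n m k b0 b K W theta) <= 40 * (m * (k * n)).
Proof.
move=> k0 km mn; have n0 : 0 < n by lia.
have kn : 0 < k <= n by rewrite k0 (leq_trans km).
have HW := opcount_W_poly b W theta n0 k0.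
rewrite /compose_at opcount_bind.
move: (opcount (W_poly _ _ _ _ _)) HW => cW HW; case: (result _) => W1 W2.
rewrite !opcount_bind addn0 opcount_scaleP.
set T := result (trig_table _ _ _); set X := result (scaleP _ _ _).
have HT := opcount_trig_table n W1 k0.
have HQ (c : fourier R * fourier R -> fourier R) :
    m * (k * n) <= opcount (mkseqM m (fun j => fourierP n k (c (K j)) T))
      <= m * (6 * (k * n)) /\
    opcount (hornerP k (result (mkseqM m (fun j => fourierP n k (c (K j)) T))) X)
      <= m * (3 * (k * k)).
  split.
    rewrite opcount_mkseqM_ge ?opcount_mkseqM_le// => j _.
      exact: opcount_fourierP_le.
    exact: opcount_fourierP_ge.
  apply: leq_trans (opcount_hornerP _ _ k0) _.
  by rewrite result_mkseqM size_mkseq.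
have [/andP[L1 U1] H1] := HQ fst; have [/andP[_ U2] H2] := HQ snd.
have knm : k * n <= m * (k * n) by rewrite leq_pmull// (leq_trans k0).
have nkk : n * (k * k) <= m * (k * n) 
  by rewrite mulnCA mulnA [k * n]mulnC mulnA leq_mul// [n * k]mulnC leq_mul.
have mkk : m * (k * k) <= m * (k * n) by rewrite !leq_mul//; lia.
have kkn : k <= k * n by rewrite leq_pmulr.
apply/andP; split; first by lia.
by move: HW HT U1 H1 U2 H2; lia.
Qed.

(** The extra unit in 41 pays for the division i / n. *)
Lemma opcount_compose_mesh n m k (b0 b : R) (K W : fourier2s R) :
  0 < k -> k <= m -> m <= n ->
  m * k * n ^ 2 <= opcount (compose_mesh n m k b0 b K W) <= 41 * (m * k * n ^ 2).
Proof.
move=> k0 km mn; have E : m * k * n ^ 2 = n * (m * (k * n)) by lia.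
have C theta := opcount_compose_at b0 b K W theta k0 km mn.
have mkn : 0 < m * (k * n) by rewrite !muln_gt0; lia.
rewrite E [41 * _]mulnCA; apply/andP; split.
  apply: opcount_mkseqM_ge => i _; rewrite opcount_bind.
  by have /andP[L _] := C (result (divM i%:R n%:R : Defs.comp R)); lia.
apply: opcount_mkseqM_le => i _; rewrite opcount_bind.
have /andP[_ U] := C (result (divM i%:R n%:R : Defs.comp R)).
by rewrite [opcount (divM _ _)]/=; lia.
Qed.

End Complexity.

Theorem theorem5p6 (R : realType) :
  exists c1 c2 : R, 0 < c1 /\ 0 < c2 /\
  forall (k m n : nat), (0 < k)%N -> (k <= m)%N -> (m <= n)%N ->
  forall (b0 b : R), 0 < b0 -> 0 < b ->
  forall K W Wt : fourier2s R,
  let run := compositions n m k b0 b K W Wt in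
  [/\ is_composition n m k b0 b K W (result run).1,
      is_composition n m k b0 b K Wt (result run).2,
      c1 * (m * k * n ^ 2)%:R <= (opcount run)%:R
    & (opcount run)%:R <= c2 * (m * k * n ^ 2)%:R].
Proof.
(* The two compositions cost between 1 and 41 times m k n ^ 2 each. *)
exists 2, 82; split=> //; split=> // k m n k0 km mn b0 b _ _ K W Wt run.
have n0 : (0 < n)%N by rewrite (leq_trans k0)// (leq_trans km).
have add_bounds x y z : (x <= y <= 41 * x -> x <= z <= 41 * x ->
  2 * x <= y + z <= 82 * x)%N by lia.
have /andP[L U] := add_bounds _ _ _ (opcount_compose_mesh b0 b K W k0 km mn)
                                    (opcount_compose_mesh b0 b K Wt k0 km mn).
have [run1 run2 run_cost] : [/\ (result run).1 = result (compose_mesh n m k b0 b K W),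
    (result run).2 = result (compose_mesh n m k b0 b K Wt)
  & opcount run = (opcount (compose_mesh n m k b0 b K W)
                   + opcount (compose_mesh n m k b0 b K Wt))%N].
  rewrite {}/run /compositions.
  move: (compose_mesh n m k b0 b K W) (compose_mesh n m k b0 b K Wt) => C Ct.
  by rewrite !opcount_bind addn0.
rewrite run1 run2 run_cost; split.
- exact: compose_mesh_correct.
- exact: compose_mesh_correct.
- by rewrite -natrM ler_nat; exact: L.
- by rewrite -natrM ler_nat; exact: U.
Qed.
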